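(* Let $X$ and $Y$ be Banach spaces, and assume that $Y$ satisfies asymptotic lower $\ell_p$-estimates for some $p\in[1,\infty)$. Assume that there exists a weakly sequentially continuous map $f:X\to Y$ which is coarse and satisfies Property $( * )$. Then $X$ has the $p$-co-Banach-Saks property.
   Context: Maps. For a map $f:X\to Y$ between Banach spaces (not assumed linear) let $\omega_f(t)=\sup\{\|f(x)-f(y)\| : \|x-y\|\le t\}$ for $t\ge 0$. The map $f$ is coarse if $\omega_f(t)<\infty$ for all $t\ge 0$. It satisfies Property $( * )$ if there exist $\beta>\alpha>0$ such that $\inf_{\|x-y\|\in[\alpha,\beta]}\|f(x)-f(y)\|>0$. It is weakly sequentially continuous if $x_n\to x$ weakly in $X$ implies $f(x_n)\to f(x)$ weakly in $Y$. Asymptotic lower estimates. Let $\partial B_Z$ be the unit sphere of a normed space $Z$ and $\mathrm{cof}(Y)$ the set of closed finite-codimensional subspaces of $Y$. For $C>0$ let $G_{p,C}$ be the set of finite tuples $(y_1,\ldots,y_k)$ of elements of $\partial B_Y$ such that $\|\sum_{j=1}^k a_jy_j\|\ge C(\sum_{j=1}^k|a_j|^p)^{1/p}$ for all $a_1,\ldots,a_k\in\mathbb{R}$. For $k\in\mathbb{N}$ consider the $k$-round game in which, in round $j$, Player I chooses $Y_j\in\mathrm{cof}(Y)$ and then Player II chooses $y_j\in\partial B_{Y_j}$; Player I wins if $(y_1,\ldots,y_k)\in G_{p,C}$. Player I has a winning strategy if \[\exists Y_1\in\mathrm{cof}(Y)\ \forall y_1\in\partial B_{Y_1}\ \ldots\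 \exists Y_k\in\mathrm{cof}(Y)\ \forall y_k\in\partial B_{Y_k}:\ (y_1,\ldots,y_k)\in G_{p,C}.\] $Y$ satisfies asymptotic lower $\ell_p$-estimates if there is $C>0$ such that Player I has a winning strategy in this game for every $k\in\mathbb{N}$. Spreading models. Let $(x_n)_n$ be a bounded sequence without Cauchy subsequences in a Banach space $(X,\|\cdot\|)$. A sequence $(e_n)_n$ in a Banach space $(S,\|\cdot\|_S)$ is the spreading model of $(x_n)_n$ if for all $\varepsilon>0$ and $k\in\mathbb{N}$ there is $\ell\in\mathbb{N}$ such that $\big|\,\|\sum_{i=1}^k a_ix_{n_i}\|-\|\sum_{i=1}^k a_ie_i\|_S\,\big|\le\varepsilon$ for all $\ell\le n_1<\ldots<n_k$ and all $a_1,\ldots,a_k\in[-1,1]$. $X$ has the $p$-co-Banach-Saks property if there is $C>0$ such that every spreading model $(e_n)_n$ in a Banach space $(S,\|\cdot\|_S)$ of a normalized weakly null sequence in $X$ satisfies $\|e_1+\ldots+e_k\|_S\ge Ck^{1/p}$ for all $k\in\mathbb{N}$. *)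

(* Defs.v *)
From HB Require Import structures.
From mathcomp Require Import all_boot all_order all_algebra.
From mathcomp Require Import all_classical all_reals all_analysis.

Set Implicit Arguments.
Unset Strict Implicit.
Unset Printing Implicit Defensive.

Import Order.TTheory GRing.Theory Num.Theory.
Import numFieldNormedType.Exports.

Local Open Scope classical_set_scope.
Local Open Scope ring_scope.

(* Real Banach spaces are the [completeNormedModType R] with [R : realType]. *)

Section Maps.
Context {R : realType} {X Y : completeNormedModType R}.

(* The supremum and the infimum below are taken in [\bar R]; in particular the
   infimum over an empty set of pairs is [+oo]. *)
Definition expansion_modulus (f : X -> Y) (t : R) : \bar R :=
  ereal_sup [set (`|f xy.1 - f xy.2|)%:E | xy in
              [set xy : X * X | `|xy.1 - xy.2| <= t]].

Definition coarse (f : X -> Y) : Prop :=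
  forall t : R, 0 <= t -> (expansion_modulus f t < +oo)%E.

Definition property_star (f : X -> Y) : Prop :=
  exists alpha beta : R, [/\ 0 < alpha, alpha < beta &
    (0 < ereal_inf [set (`|f xy.1 - f xy.2|)%:E | xy in
           [set xy : X * X | (alpha <= `|xy.1 - xy.2| <= beta)%R]])%E].

End Maps.

Definition weak_cvg {R : realType} {X : completeNormedModType R}
    (x : nat -> X) (l : X) : Prop :=
  forall phi : {linear X -> R^o}, continuous phi ->
    phi (x n) @[n --> \oo] --> phi l.

Definition weakly_seq_continuous {R : realType} {X Y : completeNormedModType R}
    (f : X -> Y) : Prop :=
  forall (x : nat -> X) (l : X), weak_cvg x l -> weak_cvg (f \o x) (f l).

Section AsymptoticLowerEstimates.
Context {R : realType} {Y : completeNormedModType R}.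

(* Finite codimension: the cosets of finitely many vectors span [Y / V]. *)
Definition cof (V : set Y) : Prop :=
  [/\ GRing.submod_closed (mem V), closed V &
      exists (n : nat) (v : 'I_n -> Y), forall y : Y,
        exists c : 'I_n -> R, V (y - \sum_(i < n) c i *: v i)].

Definition lower_lp (p C : R) (ys : seq Y) : Prop :=
  (forall y, y \in ys -> `|y| = 1) /\
  forall a : 'I_(size ys) -> R,
    C * (\sum_(j < size ys) `|a j| `^ p) `^ p^-1
      <= `|\sum_(j < size ys) a j *: ys`_j|.

(* Player I has a winning strategy for target set [G] when [k] rounds remain
   and Player II has already picked the vectors of [ys], in that order. *)
Fixpoint playerI_wins (G : seq Y -> Prop) (k : nat) (ys : seq Y) : Prop :=
  if k is k'.+1 then
    exists V : set Y, cof V /\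
      forall y : Y, V y -> `|y| = 1 -> playerI_wins G k' (rcons ys y)
  else G ys.

End AsymptoticLowerEstimates.

Definition asymptotic_lower_lp {R : realType} (Y : completeNormedModType R)
    (p : R) : Prop :=
  exists C : R, 0 < C /\
    forall k : nat, playerI_wins (@lower_lp R Y p C) k [::].

Section SpreadingModels.
Context {R : realType}.

(* Sequences are indexed from 0, so [e_1 + ... + e_k] is the sum of the
   [e i] for [i < k]. *)
Definition spreading_model {X S : completeNormedModType R}
    (x : nat -> X) (e : nat -> S) : Prop :=
  [/\ bounded_fun x,
      forall g : nat -> nat, increasing_seq g ->
        ~ cauchy ((x \o g) n @[n --> \oo]) &
      forall (eps : R) (k : nat), 0 < eps -> exists l : nat,
        forall (n : 'I_k -> nat) (a : 'I_k -> R),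
          (forall i, (l <= n i)%N) ->
          (forall i j : 'I_k, (i < j)%N -> (n i < n j)%N) ->
          (forall i, -1 <= a i <= 1) ->
          `| `|\sum_(i < k) a i *: x (n i)| - `|\sum_(i < k) a i *: e i| |
            <= eps].

Definition co_Banach_Saks (X : completeNormedModType R) (p : R) : Prop :=
  exists C : R, 0 < C /\
    forall (x : nat -> X) (S : completeNormedModType R) (e : nat -> S),
      (forall n, `|x n| = 1) -> weak_cvg x 0 -> spreading_model x e ->
      forall k : nat, C * k%:R `^ p^-1 <= `|\sum_(i < k) e i|.

End SpreadingModels.

(* Main.v *)
(** Let (x_n) be normalized and weakly null with spreading model (e_n). Norming
x_{n_1} and choosing the other indices far out gives |sum a_i e_i| >= |a_1|; in
particular D = |e_1 - e_2| >= 1, so s = (alpha + beta) / (2 D) is at most beta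
and s |x_n - x_m| lies in [alpha, beta] for large n < m. Property ( * ) then
makes the points f(z + s x_n) uniformly separated, so for every z the weakly
null increments f(z + s x_n) - f(z) are bounded below in norm, and they come
arbitrarily close to any closed finite-codimensional subspace. Normalized, they
are legal moves for Player II. Adding the s x_{n_j} one at a time, the increments
sum to f(s x_{n_1} + ... + s x_{n_k}) - f(0), whose norm is therefore at least of
order k^{1/p}. A coarse map grows at most affinely, so that norm is at most
M (s |x_{n_1} + ... + x_{n_k}| + 1), and since |e_1 + ... + e_k| >= 1 the additive
constant is absorbed. *)

Require Import Defs.
From HB Require Import structures.
From mathcomp Require Import all_boot all_order all_algebra.
From mathcomp Require Import all_classical all_reals all_analysis.
From mathcomp Require Import ring lra zify.
Import Order.TTheory GRing.Theory Num.Theory.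
Import numFieldNormedType.Exports.
Local Open Scope ring_scope.

(** * The Hahn-Banach theorem via minimal sublinear functionals *)

Section HahnBanach.
Local Open Scope classical_set_scope.
Local Open Scope ring_scope.
Context {R : realType} {V : lmodType R}.
Implicit Types (p q : V -> R) (x y v : V).

(** Homogeneity is asked as an inequality, the side that passes to infima; scaling back by [a^-1]
    gives equality. *)
Definition sublinear p :=
  (forall x y, p (x + y) <= p x + p y) /\
  (forall a x, 0 < a -> p (a *: x) <= a * p x).

Lemma sublinearZ p a x : sublinear p -> 0 < a -> p (a *: x) = a * p x.
Proof.
move=> [_ pZ] a0; apply/eqP; rewrite eq_le pZ//=.
rewrite -ler_pdivlMl// -{1}(scalerK (lt0r_neq0 a0) x).
by rewrite pZ// invr_gt0.
Qed.

Lemma sublinear0 p : sublinear p -> p 0 = 0.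
Proof.
move=> sp; have := @sublinearZ p 2 0 sp (ltr0Sn _ 1).
by rewrite scaler0 => h; lra.
Qed.

Lemma sublinearN p x : sublinear p -> - p (- x) <= p x.
Proof.
move=> sp; have := sp.1 x (- x); rewrite subrr (sublinear0 _ sp) => h; lra.
Qed.

Lemma lb_le_infD (A B : set R) (c : R) : A !=set0 -> B !=set0 ->
  (forall a b, A a -> B b -> c <= a + b) -> c <= inf A + inf B.
Proof.
move=> A0 B0 h; rewrite -lerBlDr; apply: lb_le_inf => // a Aa.
rewrite lerBlDr -lerBlDl; apply: lb_le_inf => // b Bb.
by rewrite lerBlDl; exact: h.
Qed.

Lemma lb_le_infM (A : set R) (a c : R) : A !=set0 -> 0 < a ->
  (forall t, A t -> c <= a * t) -> c <= a * inf A.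
Proof.
move=> A0 a0 h; rewrite -ler_pdivrMl//; apply: lb_le_inf => // t At.
by rewrite ler_pdivrMl//; exact: h.
Qed.

Section Shift.
Variables (q : V -> R) (v : V).
Hypothesis sq : sublinear q.

Let shift_set x := [set q (x + t *: v) - t * q v | t in [set t | 0 <= t]].

(* The largest sublinear functional below [q] taking the value [- q v] at [- v]. *)
Definition sublinear_shift x := inf (shift_set x).

Let shift_set0 x : shift_set x !=set0.
Proof. by exists (q (x + 0 *: v) - 0 * q v); exists 0 => //=. Qed.

Let tqv t : 0 <= t -> q (t *: v) = t * q v.
Proof.
rewrite le_eqVlt => /orP[/eqP <-|]; last exact: sublinearZ.
by rewrite scale0r mul0r sublinear0.
Qed.

Let shift_le x t : 0 <= t -> sublinear_shift x <= q (x + t *: v) - t * q v.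
Proof.
move=> t0; apply: ge_inf; last by exists t.
(* Subadditivity at [x + u *: v] and [- x] bounds the set from below. *)
exists (- q (- x)) => _ [u /= u0 <-].
have := sq.1 (x + u *: v) (- x); rewrite addrAC subrr add0r tqv// => h; lra.
Qed.

Lemma sublinear_shift_le x : sublinear_shift x <= q x.
Proof. by have := @shift_le x 0 (lexx _); rewrite scale0r mul0r addr0 subr0. Qed.

Lemma sublinear_shiftD x : sublinear_shift x <= q (x + v) - q v.
Proof. by have := @shift_le x 1 ler01; rewrite scale1r mul1r. Qed.

Lemma sublinear_shiftP : sublinear sublinear_shift.
Proof.
split=> [x y|a x a0].
  apply: lb_le_infD => // _ _ [s /= s0 <-] [t /= t0 <-].
  apply: le_trans (@shift_le _ _ (addr_ge0 s0 t0)) _.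
  by have := sq.1 (x + s *: v) (y + t *: v); rewrite addrACA -scalerDl => h; lra.
apply: lb_le_infM => // _ [t /= t0 <-].
apply: le_trans (@shift_le _ (a * t) _) _; first by rewrite mulr_ge0// ltW.
by rewrite -scalerA -scalerDr sublinearZ// mulrBr mulrA.
Qed.

End Shift.

(** Zorn's lemma for the reversed pointwise order: a nonempty chain is bounded by its pointwise
    infimum, the empty one by [p]. *)
Lemma minimal_sublinear p : sublinear p ->
  exists q, [/\ sublinear q, forall x, q x <= p x &
    forall r, sublinear r -> (forall x, r x <= q x) -> r = q].
Proof.
move=> sp; pose T := {q : V -> R | sublinear q /\ forall x, q x <= p x}.
pose ord (r s : T) := `[< forall x, sval s x <= sval r x >].
have [|r s t|r s|A totA|[q [sq qp]] qmin] := @Zorn T ord.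
- by move=> t; apply/asboolP.
- by move=> /asboolP h1 /asboolP h2; apply/asboolP => x; exact: le_trans (h2 x) (h1 x).
- move=> /asboolP h1 /asboolP h2; case: r s h1 h2 => [r hr] [s hs] /= h1 h2.
  by apply: eq_exist; apply/funext => x; apply/eqP; rewrite eq_le h2 h1.
- have [->|/set0P[q0 Aq0]] := eqVneq A set0.
    by exists (exist _ p (conj sp (fun x => lexx (p x)))).
  pose E x := [set sval r x | r in A].
  have E0 x : E x !=set0 by exists (sval q0 x); exists q0.
  have infE (r : T) x : A r -> inf (E x) <= sval r x.
    move=> Ar; apply: ge_inf; last by exists r.
    exists (- p (- x)) => _ [s _ <-]; have [ss sp'] := svalP s.
    by have := sublinearN _ x ss; have := sp' (- x); lra.
  have sE : sublinear (fun x => inf (E x)).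
    split=> [x y|a x a0].
      apply: lb_le_infD => // _ _ [r Ar <-] [s As <-].
      (* The smaller of [r] and [s] serves at both [x] and [y]. *)
      have [/asboolP le_|/asboolP le_] := totA _ _ Ar As.
        have [ss _] := svalP s; apply: le_trans (infE _ _ As) _.
        by apply: le_trans (ss.1 _ _) _; rewrite lerD2r.
      have [ss _] := svalP r; apply: le_trans (infE _ _ Ar) _.
      by apply: le_trans (ss.1 _ _) _; rewrite lerD2l.
    apply: lb_le_infM => // _ [r Ar <-]; have [sr _] := svalP r.
    by apply: le_trans (infE _ _ Ar) _; exact: sr.2.
  have Ep x : inf (E x) <= p x.
    by apply: le_trans (infE _ _ Aq0) _; have [_] := svalP q0; exact.
  pose t : T := exist _ (fun x => inf (E x)) (conj sE Ep).
  by exists t => s As; apply/asboolP => x; exact: infE.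
exists q; split=> // r sr rq.
have rp x : r x <= p x := le_trans (rq x) (qp x).
pose t : T := exist _ r (conj sr rp).
have /qmin : ord (exist _ q (conj sq qp)) t by exact/asboolP.
by move=> /(congr1 sval).
Qed.

(* A minimal sublinear functional equals each of its shifts, hence is additive. *)
Lemma hahn_banach p v : sublinear p ->
  exists f : {linear V -> R^o}, (forall x, f x <= p x) /\ f v = p v.
Proof.
(* Minimizing below the shift of [p] by [v] forces [q (- v) <= - p v], hence [q v = p v] in the
   end. *)
move=> sp; have [q [sq qp qmin]] := minimal_sublinear _ (sublinear_shiftP _ v sp).
have qD x y : q (x + y) = q x + q y.
  apply/eqP; rewrite eq_le sq.1/= -lerBrDr.
  apply: le_trans (sublinear_shiftD _ y sq x).
  by have -> := qmin _ (sublinear_shiftP _ y sq) (sublinear_shift_le _ y sq).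
have qN x : q (- x) = - q x.
  by have := qD x (- x); rewrite subrr sublinear0// => h; lra.
have qZ a x : q (a *: x) = a * q x.
  have [a0|a0|->] := ltgtP a 0; last by rewrite scale0r mul0r sublinear0.
    have /= := @sublinearZ q (- a) x sq; rewrite oppr_gt0 scaleNr qN => /(_ a0).
    by rewrite mulNr => /oppr_inj.
  exact: sublinearZ.
have lq : linear (q : V -> R^o) by move=> a x y; rewrite qD qZ.
pose f : {linear V -> R^o} := HB.pack (q : V -> R^o) (GRing.isLinear.Build _ _ _ _ _ lq).
have fp x : f x <= p x := le_trans (qp x) (sublinear_shift_le _ v sp x).
exists f; split=> //; apply/eqP; rewrite eq_le fp/=.
have := qp (- v); have := sublinear_shiftD _ v sp (- v).
rewrite addNr sublinear0// sub0r => h1 h2.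
change (p v <= q v); have := qN v; lra.
Qed.

End HahnBanach.

(** * Norming and separating functionals *)

Section Functionals.
Local Open Scope classical_set_scope.
Local Open Scope ring_scope.
Context {R : realType} {V : normedModType R}.
Implicit Types (f : {linear V -> R^o}) (W : set V).

Lemma linear_le_norm f : (forall x, f x <= `|x|) -> forall x, `|f x| <= `|x|.
Proof.
by move=> fle x; rewrite ler_norml fle andbT lerNl -linearN -(normrN x).
Qed.

Lemma linear_le_continuous f : (forall x, f x <= `|x|) -> continuous f.
Proof.
move=> /linear_le_norm fle; apply: bounded_linear_continuous.
apply/ex_bound; exists 1; near=> x; apply: le_trans (fle x) _; near: x.
exact: (@nbhs0_le R V 1).
Unshelve. all: by end_near. Qed.

Lemma norming_functional (x : V) : exists f,
  [/\ continuous f, forall y, `|f y| <= `|y| & f x = `|x|].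
Proof.
have [|f [fle fx]] := @hahn_banach R V (fun y : V => `|y|) x.
  split=> [y z|a y a0]; first exact: ler_normD.
  by rewrite normrZ gtr0_norm.
exists f; split=> //; first exact: linear_le_continuous.
exact: linear_le_norm.
Qed.

(** The distance to [W] is sublinear, vanishes on [W] and is positive at [v] because [W] is closed.
    A functional below it that agrees with it at [v] is rescaled. *)
Lemma separating_functional W (v : V) :
  GRing.submod_closed (mem W) -> closed W -> ~ W v ->
  exists f, [/\ continuous f, forall w, W w -> f w = 0 & f v = 1].
Proof.
move=> [+ Wlin] cW Wv; rewrite inE => W0.
have WD (x y : V) : W x -> W y -> W (x + y).
  by move=> Wx Wy; have := Wlin 1 x y; rewrite scale1r !inE; exact.
have WZ a (x : V) : W x -> W (a *: x).
  by move=> Wx; have := Wlin a x 0; rewrite addr0 !inE; exact.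
pose E (x : V) := [set `|x - w| | w in W].
have E0 x : E x !=set0 by exists `|x - 0|; exists 0.
have infE x w : W w -> inf (E x) <= `|x - w|.
  by move=> Ww; apply: ge_inf; [exists 0 => _ [u _ <-]|exists w].
(* [inf (E x)] is the distance from [x] to [W]. *)
have [|f [fle fv]] := @hahn_banach R V (fun x => inf (E x)) v.
  split=> [x y|a x a0].
    apply: lb_le_infD => // _ _ [u Wu <-] [w Ww <-].
    apply: le_trans (infE _ _ (WD _ _ Wu Ww)) _.
    by rewrite opprD addrACA ler_normD.
  apply: lb_le_infM => // _ [w Ww <-].
  apply: le_trans (infE _ _ (WZ a _ Ww)) _.
  by rewrite -scalerBr normrZ gtr0_norm.
have fn x : f x <= `|x|.
  by apply: le_trans (fle x) _; rewrite -[leRHS](congr1 _ (subr0 x)) infE.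
have fW w : W w -> f w = 0.
  have fW_le u : W u -> f u <= 0.
    by move=> Wu; apply: le_trans (fle u) _; have := infE u u Wu; rewrite subrr normr0.
  move=> Ww; apply/eqP; rewrite eq_le fW_le//= -oppr_le0 -linearN fW_le//.
  by rewrite -scaleN1r; exact: WZ.
have fv0 : 0 < f v.
  rewrite lt_neqAle eq_sym fv lb_le_inf ?andbT//; last by move=> _ [w _ <-].
  apply/eqP => dv0; apply: Wv; have /closure_id -> := cW.
  move=> B /nbhs_ballP[e /= e0 Be].
  have [|_ [w Ww <-] we] := @inf_lt _ (E v) e (E0 v); first by rewrite dv0.
  by exists w; split=> //; apply: Be; rewrite -ball_normE.
have lg : linear ((fun x => (f v)^-1 * f x) : V -> R^o).
  by move=> a x y; rewrite linearP mulrDr scalerAr.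
pose g : {linear V -> R^o} :=
  HB.pack ((fun x => (f v)^-1 * f x) : V -> R^o) (GRing.isLinear.Build _ _ _ _ _ lg).
exists g; split=> [x|w Ww|] /=.
- by apply: cvgMl_tmp; exact: linear_le_continuous.
- change ((f v)^-1 * f w = 0 :> R); rewrite (fW w Ww); exact: mulr0.
- by change ((f v)^-1 * f v = 1); rewrite mulVf// lt0r_neq0.
Qed.

End Functionals.

(** * Weakly null sequences and finite-codimensional subspaces *)

Section WeakConvergence.
Local Open Scope classical_set_scope.
Local Open Scope ring_scope.
Context {R : realType} {Y : completeNormedModType R}.

(* Induction on the codimension: a functional [g] vanishing on [V] with
   [g v = 1] makes [V' = {y | y - g y v \in V}] closed of smaller codimension,
   and composing a projection onto [V'] with [y |-> y - g y v] reaches [V]. *)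
Lemma cof_approx_projection (V : set Y) : cof V -> exists P : Y -> Y,
  (forall y, V (P y)) /\
  forall d : nat -> Y, weak_cvg d 0 -> d n - P (d n) @[n --> \oo] --> 0.
Proof.
move=> [Vsub Vcl [n [v]]]; elim: n => [|n IHn] in V Vsub Vcl v * => spanV.
  (* With an empty spanning family, [V] is the whole space. *)
  exists id; split=> [y|d _].
    by have [c] := spanV y; rewrite big_ord0 subr0.
  by rewrite (_ : (fun n => _) = cst 0); [exact: cvg_cst|apply/funext => n; exact: subrr].
have [Vv|Vv] := pselect (V (v ord0)).
  apply: (IHn V Vsub Vcl (fun i => v (lift ord0 i))) => y.
  have [c] := spanV y; rewrite big_ord_recl opprD addrCA => h.
  exists (fun i => c (lift ord0 i)).
  have := Vsub.2 (c ord0) _ _ (mem_set Vv) (mem_set h); rewrite inE.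
  by rewrite addNKr.
have [g [gc gV gv]] := separating_functional _ _ Vsub Vcl Vv.
pose V' : set Y := [set y | V (y - g y *: v ord0)].
have projc : continuous (fun y : Y => y - g y *: v ord0).
  move=> y; apply: cvgB; first exact: cvg_id.
  by apply: cvgZr_tmp; exact: gc.
have V'cl : closed V' by apply: preimage_closed => // y _; exact: projc.
have V'sub : GRing.submod_closed (mem V').
  have [V0 Vlin] := Vsub.
  split=> [|a x y]; rewrite !inE /V' /= ?linear0 ?scale0r ?subr0; first by move: V0; rewrite inE.
  move=> Vx Vy; have := Vlin a _ _ (mem_set Vx) (mem_set Vy); rewrite inE.
  by rewrite linearP scalerBr scalerDl opprD addrACA scalerA.
have [y|P [PV Pd]] := IHn V' V'sub V'cl (fun i => v (lift ord0 i)).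
  have [c] := spanV y; rewrite big_ord_recl opprD addrCA => h.
  exists (fun i => c (lift ord0 i)); rewrite /V' /=; set u := y - _ in h *.
  (* Applying [g] to [h] identifies [c ord0] as [g u], so [h] says that [u] is in [V']. *)
  have := gV _ h; rewrite linearD linearN linearZ /= gv => /eqP.
  rewrite addrC subr_eq0 => /eqP ->; rewrite /GRing.scale /= mulr1.
  by rewrite addrC.
exists (fun y => P y - g (P y) *: v ord0); split=> [y|d d0]; first exact: PV.
(* The correction vanishes in the limit: [g (d n)] by weak convergence, [g (d n - P (d n))] by
   continuity. *)
have gP : g (P (d n)) @[n --> \oo] --> 0.
  have -> : (fun n => g (P (d n))) = (fun n => g (d n) - g (d n - P (d n))).
    by apply/funext => k; rewrite linearB opprB addrC subrK.
  rewrite -[X in _ --> X]subr0; apply: cvgB.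
    by have := d0 g gc; rewrite linear0.
  by rewrite -(linear0 g); apply: continuous_cvg (Pd d d0); exact: gc.
have dE k : d k - (P (d k) - g (P (d k)) *: v ord0) =
    d k - P (d k) + g (P (d k)) *: v ord0 by rewrite opprB addrA addrAC.
rewrite (funext dE).
have := cvgD (Pd d d0) (cvgZr_tmp (a := v ord0) gP).
by rewrite scale0r addr0; apply.
Qed.

End WeakConvergence.

(** * Quantitative forms of the hypotheses on the map *)

Section Maps.
Context {R : realType} {X Y : completeNormedModType R}.

Lemma weak_cvg_affine (x : nat -> X) (z : X) (s : R) :
  weak_cvg x 0 -> weak_cvg (fun n => z + s *: x n) z.
Proof.
move=> x0 phi phic; have phiE n : phi (z + s *: x n) = phi z + s *: phi (x n).
  by rewrite linearD linearZ.
rewrite (funext phiE) -[X in (_ --> X)%classic]addr0; apply: cvgD; first exact: cvg_cst.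
rewrite -(scaler0 _ s) -(linear0 phi); apply: cvgZl_tmp; exact: x0.
Qed.

Lemma weak_cvgB (y : nat -> Y) (l : Y) :
  weak_cvg y l -> weak_cvg (fun n => y n - l) 0.
Proof.
move=> yl phi phic; rewrite linear0.
have phiE n : phi (y n - l) = phi (y n) - phi l by rewrite linearB.
rewrite (funext phiE) -(subrr (phi l)).
by apply: cvgB; [exact: yl|exact: cvg_cst].
Qed.

(** A segment of length at most [n] splits into [n] steps of length at most 1, each costing at most
    [M], the modulus at 1; [n] is then one more than the integer part of the distance. *)
Lemma coarse_affine_bound (f : X -> Y) : coarse f ->
  exists2 M : R, 0 <= M & forall x y, `|f x - f y| <= M * (`|x - y| + 1).
Proof.
move=> /(_ 1 ler01); set w := expansion_modulus f 1 => woo.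
have wle x y : `|x - y| <= 1 -> ((`|f x - f y|)%:E <= w)%E.
  by move=> xy; apply: ereal_sup_ubound; exists (x, y).
have w0 : (0 <= w)%E by have := wle 0 0; rewrite !subrr !normr0; exact.
have wfin : w \is a fin_num by rewrite ge0_fin_numE.
pose M := fine w; have M0 : 0 <= M by exact: fine_ge0.
have fM x y : `|x - y| <= 1 -> `|f x - f y| <= M.
  by move=> /wle; rewrite -(fineK wfin) lee_fin.
have fMn n x y : `|x - y| <= n%:R -> `|f x - f y| <= M * n%:R.
  elim: n x y => [|n IHn] x y.
    by rewrite normr_le0 subr_eq0 => /eqP ->; rewrite subrr normr0 mulr0.
  move=> xy; pose z := y + (n%:R / n.+1%:R) *: (x - y).
  have n1 : (0 : R) < n.+1%:R by rewrite ltr0Sn.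
  have xz : `|x - z| <= 1.
    have -> : x - z = n.+1%:R^-1 *: (x - y).
      rewrite /z opprD addrA -{1}[x - y]scale1r -scalerBl; congr (_ *: _).
      by rewrite -natr1 in n1 *; field; exact: lt0r_neq0.
    by rewrite normrZ gtr0_norm ?invr_gt0// ler_pdivrMl// mulr1.
  have zy : `|z - y| <= n%:R.
    rewrite /z addrAC subrr add0r normrZ ger0_norm; last by rewrite divr_ge0.
    by rewrite -mulrA ler_piMr// ler_pdivrMl// mulr1.
  have -> : f x - f y = (f x - f z) + (f z - f y) by rewrite addrA subrK.
  apply: le_trans (ler_normD _ _) _; rewrite -natr1 mulrDr mulr1 addrC.
  by rewrite lerD ?IHn ?fM.
exists M => // x y; have := truncn_itv (normr_ge0 (x - y)); set n := Num.truncn _ => /andP[nle lt_n].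
apply: le_trans (fMn n.+1 x y (ltW lt_n)) _.
by rewrite ler_wpM2l// -natr1 lerD2r.
Qed.

Lemma property_starP (f : X -> Y) : property_star f ->
  exists alpha beta delta : R, [/\ 0 < alpha, alpha < beta, 0 < delta &
    forall x y, alpha <= `|x - y| <= beta -> delta <= `|f x - f y|].
Proof.
move=> [a [b [a0 ab]]]; set I := ereal_inf _ => I0.
have Ile x y : a <= `|x - y| <= b -> (I <= (`|f x - f y|)%:E)%E.
  by move=> xy; apply: ereal_inf_lbound; exists (x, y).
exists a, b; case: I I0 Ile => [d| |]//= d0 Ile.
- by exists d; split=> // x y /Ile; rewrite lee_fin.
(* An infimum [+oo] means that no pair has its distance in the interval. *)
- by exists 1; split=> // x y /Ile.
Qed.

End Maps.

(** * A lower bound for spreading models of weakly null sequences *)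

Section SpreadingModels.
Context {R : realType} {X S : completeNormedModType R}.

Lemma spreading_model_ge_head (x : nat -> X) (e : nat -> S) (k : nat)
    (a : 'I_k.+1 -> R) :
  (forall n, `|x n| = 1) -> weak_cvg x 0 -> spreading_model x e ->
  (forall i, -1 <= a i <= 1) -> `|a ord0| <= `|\sum_(i < k.+1) a i *: e i|.
Proof.
move=> x1 x0 [_ _ xe] a1; apply/ler_addgt0Pr => eps eps0.
have eps2 : 0 < eps / 2 by rewrite divr_gt0.
have [l xel] := xe (eps / 2) k.+1 eps2.
have [phi [phic phile phil]] := norming_functional (x l).
(* The tail terms under [phi] cost at most [eps / 2] together; the other half pays for passing from
   [x] to [e]. *)
have eta0 : 0 < eps / 2 / k.+1%:R by rewrite divr_gt0.
have := x0 phi phic; rewrite linear0 => /cvgr0Pnorm_le /(_ _ eta0) [L _ phiL].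
(* Later positions have [i >= 1], so their indices exceed [l] strictly. *)
pose n (i : 'I_k.+1) := if i == ord0 then l else (maxn l L + i)%N.
have ln i : (l <= n i)%N by rewrite /n; case: ifP => // _; lia.
have nS (i j : 'I_k.+1) : (i < j)%N -> (n i < n j)%N.
  rewrite /n -!val_eqE /=; case: eqP => [->|_] ij; last by rewrite ifF; [lia|apply/eqP; lia].
  by rewrite ifF; [lia|apply/eqP; lia].
have := xel n a ln nS a1; rewrite ler_norml => /andP[_ h].
suff : `|a ord0| <= `|\sum_(i < k.+1) a i *: x (n i)| + eps / 2 by lra.
pose t : R := \sum_(i < k) a (lift ord0 i) * phi (x (n (lift ord0 i))).
have phi_sum : phi (\sum_(i < k.+1) a i *: x (n i)) = a ord0 + t.
  rewrite linear_sum big_ord_recl linearZ /= {1}/n eqxx phil x1.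
  congr (_ + _); first exact: mulr1.
  by apply: eq_bigr => i _; rewrite linearZ.
have := phile (\sum_(i < k.+1) a i *: x (n i)); rewrite phi_sum.
have := ler_normB (a ord0 + t) t; rewrite addrK.
suff : `|t| <= eps / 2 by rewrite -[`|a ord0 + t : R^o|]/`|a ord0 + t : R|; lra.
apply: le_trans (ler_norm_sum _ _ _) _.
have -> : eps / 2 = \sum_(i < k.+1) (eps / 2 / k.+1%:R).
  by rewrite sumr_const card_ord -[RHS]mulr_natr divfK.
rewrite [leRHS]big_ord_recl -[leLHS]add0r lerD ?(ltW eta0)//.
apply: ler_sum => i _; rewrite normrM.
have -> : n (lift ord0 i) = (maxn l L + i.+1)%N by rewrite /n -val_eqE.
rewrite -[leRHS]mul1r ler_pM//; first by rewrite ler_norml a1.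
by apply: phiL => /=; lia.
Qed.

End SpreadingModels.

(** * Playing increments of the map against the winning strategy *)

Section Game.
Context {R : realType} {X Y : completeNormedModType R}.

(** The base point moves from [z] to [z + u m] after each round, so the increments telescope and the
    errors add up. Each pair in [bs] holds a coefficient and Player II's unit vector. *)
Lemma playerI_wins_increments (G : seq Y -> Prop) (f : X -> Y) (u : nat -> X)
    (c eta : R) :
  (forall z V N, cof V -> exists m a y,
    [/\ (N < m)%N, c <= a, V y, `|y| = 1 & `|f (z + u m) - f z - a *: y| <= eta]) ->
  forall k ys z N, playerI_wins G k ys -> exists (ms : seq nat) (bs : seq (R * Y)),
    [/\ path ltn N ms, size ms = k /\ size bs = k, G (ys ++ unzip2 bs),
        all (fun b => c <= b.1) bs &
        `|f (z + \sum_(m <- ms) u m) - f z - \sum_(b <- bs) b.1 *: b.2|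
          <= k%:R * eta].
Proof.
move=> step; elim=> [|k IHk] ys z N /=.
  move=> Gys; exists [::], [::]; split=> //; first by rewrite cats0.
  by rewrite !big_nil addr0 subrr subr0 normr0 mul0r.
move=> [V [cofV win]]; have [m [a [y [Nm ca Vy y1 fz]]]] := step z V N cofV.
have [ms [bs [pms [sms sbs] Gbs cbs fms]]] := IHk _ (z + u m) m (win y Vy y1).
exists (m :: ms), ((a, y) :: bs); split=> /=.
- by rewrite Nm.
- by rewrite sms sbs.
- by rewrite -cat_rcons.
- by rewrite ca.
rewrite !big_cons /= addrA; set A := f (_ + _) in fms *.
have -> : A - f z - (a *: y + \sum_(b <- bs) b.1 *: b.2) =
    (A - f (z + u m) - \sum_(b <- bs) b.1 *: b.2) + (f (z + u m) - f z - a *: y).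
  by rewrite [RHS]addrACA subrKA opprD [- (a *: y) - _]addrC.
by apply: le_trans (ler_normD _ _) _; rewrite -natr1 mulrDl mul1r lerD.
Qed.

Lemma lower_lp_ge (p C c : R) (bs : seq (R * Y)) : 0 < p -> 0 <= C -> 0 <= c ->
  lower_lp p C (unzip2 bs) -> all (fun b => c <= b.1) bs ->
  C * (c * (size bs)%:R `^ p^-1) <= `|\sum_(b <- bs) b.1 *: b.2|.
Proof.
move=> p0 C0 c0 [_ low] /(all_nthP (0, 0)) cbs.
have pV0 : 0 <= p^-1 by rewrite invr_ge0 ltW.
have := low (fun j => (nth (0, 0) bs j).1).
have -> : \sum_(j < size (unzip2 bs)) (nth (0, 0) bs j).1 *: (unzip2 bs)`_j =
    \sum_(b <- bs) b.1 *: b.2.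
  rewrite (big_nth (0, 0)) big_mkord size_map; apply: eq_bigr => j _.
  by rewrite (nth_map (0, 0)).
apply: le_trans; rewrite ler_wpM2l//.
(* Read as the l_p norm of a constant tuple, the left side compares term by term. *)
have -> : c * (size bs)%:R `^ p^-1 = (\sum_(j < size (unzip2 bs)) c `^ p) `^ p^-1.
  rewrite sumr_const card_ord size_map -[c `^ p *+ _]mulr_natl powRM ?powR_ge0//.
  by rewrite -powRrM mulfV ?gt_eqF// powRr1// mulrC.
apply: ge0_ler_powR; rewrite ?nnegrE ?sumr_ge0//.
  by move=> *; exact: powR_ge0.
apply: ler_sum => j _; rewrite size_map in j *.
have cj := cbs j (ltn_ord j).
by rewrite ge0_ler_powR ?nnegrE ?ger0_norm// ?(ltW p0)// (le_trans c0).
Qed.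

End Game.

(** * Legal moves from increments *)

Section Increments.
Context {R : realType} {X Y : completeNormedModType R}.

(* The increments [f (z + u n) - f z] are pairwise [delta]-apart, so one of any
   two has norm at least [delta / 2]; being weakly null, they almost lie in [V]. *)
Lemma increment_near_subspace (f : X -> Y) (u : nat -> X) (delta eta : R) (l : nat) :
  weakly_seq_continuous f -> (forall z, weak_cvg (fun n => z + u n) z) ->
  0 < eta -> eta <= delta / 4 ->
  (forall z m n, (l <= m < n)%N -> delta <= `|f (z + u m) - f (z + u n)|) ->
  forall z (V : set Y) N, cof V -> exists m a y,
    [/\ (N < m)%N, delta / 4 <= a, V y, `|y| = 1
      & `|f (z + u m) - f z - a *: y| <= eta].
Proof.
move=> fw uw eta0 etad sep z V N cofV.
have [P [PV Pd]] := cof_approx_projection _ cofV.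
pose d n := f (z + u n) - f z.
have d0 : weak_cvg d 0 by apply: weak_cvgB; exact: fw (uw z).
have /cvgr0Pnorm_le /(_ _ eta0) [L _ dL] := Pd d d0.
pose m := (maxn (maxn N.+1 L) l)%N.
have [i [Ni Li di]] : exists i, [/\ (N < i)%N, (L <= i)%N & delta / 2 <= `|d i|].
  have dm : delta <= `|d m - d m.+1|.
    have -> : d m - d m.+1 = f (z + u m) - f (z + u m.+1).
      by rewrite /d opprB addrA subrK.
    by apply: sep; rewrite /m; lia.
  have := ler_normB (d m) (d m.+1).
  have [dm2 _|dm2 h] := lerP (delta / 2) `|d m|; first by exists m; split=> //; rewrite /m; lia.
  by exists m.+1; split; [rewrite /m; lia..|lra].
have dPi := dL i Li; rewrite /= in dPi.
(* The error [eta <= delta / 4] leaves at least [delta / 2 - delta / 4]. *)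
have Pge : delta / 4 <= `|P (d i)|.
  by have := ler_normD (P (d i)) (d i - P (d i)); rewrite addrC subrK; lra.
have P0 : 0 < `|P (d i)| by lra.
have [[Vsub0 Vlin] _ _] := cofV.
exists i, `|P (d i)|, (`|P (d i)|^-1 *: P (d i)); split=> //.
- have := Vlin `|P (d i)|^-1 _ _ (mem_set (PV (d i))) Vsub0.
  by rewrite addr0 inE.
- by rewrite normrZ normfV normr_id mulVf ?gt_eqF.
- by rewrite scalerA mulfV ?gt_eqF// scale1r.
Qed.

End Increments.

(** * Choice of scale and accuracies, and the final comparison *)

Theorem theorem3p10 (R : realType) (X Y : completeNormedModType R) (p : R)
    (hp : 1 <= p) (hY : asymptotic_lower_lp Y p)
    (hf : exists f : X -> Y,
        [/\ weakly_seq_continuous f, coarse f & property_star f]) :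
  co_Banach_Saks X p.
Proof.
have [f [fw fc fstar]] := hf; have [C [C0 win]] := hY.
have [M M0 fM] := coarse_affine_bound f fc.
have [al [be [de [al0 albe de0 fde]]]] := property_starP f fstar.
have be0 : 0 < be by lra.
have p0 : 0 < p by lra.
(* The upper bound will be [M * (be * (E + 1) + 1) + 1], which is at most [K * E] once [1 <= E]. *)
pose K := 1 + M + 2 * (M * be).
have Mbe : 0 <= M * be by rewrite mulr_ge0// ltW.
have K0 : 0 < K by rewrite /K; lra.
exists (C * (de / 4) / K); split; first by rewrite divr_gt0 ?mulr_gt0 ?invr_gt0.
move=> x S e x1 x0 xe [|k].
  (* For the empty sum, the power of 0 is 0 because its exponent is nonzero. *)
  by rewrite powR0 ?mulr0// invr_neq0// gt_eqF.
set E := `|_|; rewrite mulrAC ler_pdivrMr// [E * K]mulrC.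
have E1 : 1 <= E.
  have := spreading_model_ge_head x e k (fun=> 1) x1 x0 xe.
  under eq_bigr do rewrite scale1r.
  by rewrite normr1; apply=> i; lra.
pose D := `|e 0%N - e 1%N|.
have D1 : 1 <= D.
  have := spreading_model_ge_head x e 1 (fun i => if i == ord0 then 1 else -1) x1 x0 xe.
  rewrite !big_ord_recl big_ord0 /= scale1r scaleN1r addr0 normr1; apply=> i.
  by case: ifP; lra.
pose s := (al + be) / 2 / D.
have s0 : 0 < s by rewrite !divr_gt0//; lra.
have sbe : s <= be by rewrite ler_pdivrMr; nra.
have sD : s * D = (al + be) / 2 by rewrite divfK// gt_eqF//; lra.
have [_ _ spread] := xe.
(* Multiplied by [s <= be], this error is at most half the length of the interval whose midpoint is
   [s * D]. *)
have eps0 : 0 < (be - al) / 2 / be by rewrite !divr_gt0// subr_gt0.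
have [l2 xl2] := spread _ 2 eps0.
have [lk xlk] := spread 1 k.+1 ltr01.
pose u n := s *: x n.
have uw z : weak_cvg (fun n => z + u n) z by exact: weak_cvg_affine.
have sep z m n : (l2 <= m < n)%N -> de <= `|f (z + u m) - f (z + u n)|.
  move=> /andP[lm mn]; apply: fde.
  rewrite opprD addrACA subrr add0r -scalerBr normrZ gtr0_norm//.
  have := xl2 (fun i => if i == ord0 then m else n) (fun i => if i == ord0 then 1 else -1).
  rewrite !big_ord_recl !big_ord0 /= !scale1r !scaleN1r !addr0 -/D.
  have h1 (i : 'I_2) : (l2 <= if i == ord0 then m else n)%N.
    by case: ifP => // _; exact: leq_trans lm (ltnW mn).
  have h2 (i j : 'I_2) : (i < j)%N ->
      ((if i == ord0 then m else n) < (if j == ord0 then m else n))%N.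
    by case: i j => [[|[|i]] hi] [[|[|j]] hj].
  have h3 (i : 'I_2) : -1 <= (if i == ord0 then 1 else -1 : R) <= 1.
    by case: ifP; lra.
  move=> /(_ h1 h2 h3); rewrite ler_norml => /andP[].
  set N := `|x m - x n| => hl hr.
  have seps : s * ((be - al) / 2 / be) <= (be - al) / 2.
    by rewrite mulrCA ger_pMr ?divr_gt0 ?subr_gt0// ler_pdivrMr// mul1r.
  have := ler_wpM2l (ltW s0) hl; have := ler_wpM2l (ltW s0) hr.
  by rewrite mulrN mulrBr sD; lra.
(* The second bound keeps the total error over [k.+1] rounds below 1. *)
pose eta := Num.min (de / 4) k.+1%:R^-1.
have k0 : 0 < k.+1%:R :> R by rewrite ltr0n.
have eta0 : 0 < eta by rewrite lt_min divr_gt0//= invr_gt0.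
have eta_le : eta <= de / 4 by rewrite ge_min lexx.
have step := increment_near_subspace f u de eta l2 fw uw eta0 eta_le sep.
(* Starting from index [lk] puts all of [ms] in the range where [xlk] applies. *)
have [ms [bs [pms [sms sbs] Gbs cbs]]] :=
  playerI_wins_increments _ f u (de / 4) eta step k.+1 [::] 0 lk (win k.+1).
rewrite add0r => approx.
have keta : k.+1%:R * eta <= 1.
  by rewrite -(ler_pdivlMl _ _ k0) mulr1 ge_min lexx orbT.
have low : C * (de / 4 * k.+1%:R `^ p^-1) <= `|\sum_(b <- bs) b.1 *: b.2|.
  by rewrite -sbs; apply: lower_lp_ge Gbs cbs => //; lra.
have usum : \sum_(m <- ms) u m = s *: \sum_(i < k.+1) 1 *: x (nth 0%N ms i).
  rewrite (big_nth 0%N) big_mkord sms scaler_sumr.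
  by apply: eq_bigr => i _; rewrite scale1r.
have xsum : `|\sum_(i < k.+1) 1 *: x (nth 0%N ms i)| <= E + 1.
  have h1 (i : 'I_k.+1) : (lk <= nth 0%N ms i)%N.
    have /allP lms := order_path_min ltn_trans pms.
    by apply/ltnW/lms/mem_nth; rewrite sms.
  have h2 (i j : 'I_k.+1) : (i < j)%N -> (nth 0%N ms i < nth 0%N ms j)%N.
    by move=> ij; rewrite (sorted_ltn_nth ltn_trans 0%N (path_sorted pms)) ?inE ?sms.
  have h3 (i : 'I_k.+1) : -1 <= (1 : R) <= 1 by lra.
  have := xlk _ (fun=> 1) h1 h2 h3.
  have -> : \sum_(i < k.+1) (1 : R) *: e i = \sum_(i < k.+1) e i.
    by under eq_bigr do rewrite scale1r.
  by rewrite -/E ler_norml => /andP[_]; rewrite lerBlDl.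
have := fM (\sum_(m <- ms) u m) 0; rewrite subr0 {2}usum normrZ (gtr0_norm s0) => up.
have := ler_wpM2l (ltW s0) xsum.
set T := `|\sum_(i < _) _| in up * => sT.
have sbeE : s * (E + 1) <= be * (E + 1) by rewrite ler_wpM2r//; lra.
have up2 : `|f (\sum_(m <- ms) u m) - f 0| <= M * (be * (E + 1) + 1).
  by apply: le_trans up _; rewrite ler_wpM2l// lerD2r; lra.
have := ler_normB (f (\sum_(m <- ms) u m) - f 0)
  (f (\sum_(m <- ms) u m) - f 0 - \sum_(b <- bs) b.1 *: b.2).
rewrite opprB addrC subrK => tri.
rewrite mulrA in low.
suff : M * (be * (E + 1) + 1) + 1 <= K * E by lra.
have -> : M * (be * (E + 1) + 1) + 1 = M * be * (E + 1) + M + 1 by ring.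
rewrite /K; nra.
Qed.
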